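(* Let $(\mathcal{E},\mathcal{G},\mathcal{F})$ be Riemann-suitable. Then for all loop-free $C\in\mathsf{pWhile}(\mathcal{E},\mathcal{G})$ and post-expectations $f\in\mathcal{F}$ the following holds: $$\forall N\ge1:\quad\underline{\mathsf{wp}}^N[C](f)\in\mathcal{F}\quad\text{and}\quad\overline{\mathsf{wp}}^N[C](f)\in\mathcal{F},$$ and, if $f\in\mathbb{E}_{meas}$, then $$\mathsf{wp}[C](f)=\sup_{N\ge1}\underline{\mathsf{wp}}^N[C](f)=\inf_{N\ge1}\overline{\mathsf{wp}}^N[C](f).$$
   Context: Programs. Let $V$ be a finite set of program variables and $S=\mathbb{R}_{\ge 0}^V$ the set of states (functions $V\to\mathbb{R}_{\ge 0}$) with its Borel $\sigma$-algebra; $\sigma[x\mapsto\xi]$ is the state mapping $x$ to $\xi$ and agreeing with $\sigma$ elsewhere. Arithmetic expressions are measurable functions $E:S\to\mathbb{R}_{\ge 0}$; guards are measurable functions $\varphi:S\to\{\mathrm{true},\mathrm{false}\}$; $[\varphi]$ is the indicator function of $\varphi$. For a set $\mathcal{E}$ of arithmetic expressions and a set $\mathcal{G}$ of guards, loop-free programs in $\mathsf{pWhile}(\mathcal{E},\mathcal{G})$ are generated by $C ::= \mathtt{skip} \mid \mathtt{diverge} \mid x:=E \mid \mathtt{observe}(\varphi) \mid x:\approx\mathtt{unif}_{[0,1]} \mid \mathtt{if}(\varphi)\{C\}\,\mathtt{else}\,\{C\} \mid \{C\}[p]\{C\} \mid C;C$, with $x\in V$, $E\in\mathcal{E}$, $\varphi\in\mathcal{G}$,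 $p\in[0,1]\cap\mathbb{Q}$. Expectations. $\mathbb{E}$ is the set of all functions $S\to[0,\infty]$, $\mathbb{E}_{meas}$ the subset of Borel measurable ones; order, suprema, infima, $+$ and $\cdot$ are pointwise ($0\cdot\infty=0$). $f[x/E]$ is the function $\sigma\mapsto f(\sigma[x\mapsto E(\sigma)])$. Transformers. $\mathsf{wp}[C]:\mathbb{E}_{meas}\to\mathbb{E}_{meas}$: $\mathsf{wp}[\mathtt{skip}](f)=f$; $\mathsf{wp}[\mathtt{diverge}](f)=0$; $\mathsf{wp}[x:=E](f)=f[x/E]$; $\mathsf{wp}[x:\approx\mathtt{unif}_{[0,1]}](f)(\sigma)=\int_{[0,1]}f(\sigma[x\mapsto\xi])\,d\lambda(\xi)$ (Lebesgue integral); $\mathsf{wp}[\mathtt{observe}(\varphi)](f)=[\varphi]\cdot f$; $\mathsf{wp}[\mathtt{if}(\varphi)\{C_1\}\mathtt{else}\{C_2\}](f)=[\varphi]\cdot\mathsf{wp}[C_1](f)+[\neg\varphi]\cdot\mathsf{wp}[C_2](f)$; $\mathsf{wp}[\{C_1\}[p]\{C_2\}](f)=p\cdot\mathsf{wp}[C_1](f)+(1-p)\cdot\mathsf{wp}[C_2](f)$; $\mathsf{wp}[C_1;C_2](f)=\mathsf{wp}[C_1](\mathsf{wp}[C_2](f))$. For an integer $N\ge1$, $\underline{\mathsf{wp}}^N[C],\overline{\mathsf{wp}}^N[C]:\mathbb{E}\to\mathbb{E}$ are defined by the same rules (on all of $\mathbb{E}$), except that $\underline{\mathsf{wp}}^N[x:\approx\mathtt{unif}_{[0,1]}](f)=\frac1N\sum_{i=0}^{N-1}\inf_{\xi\in[i/N,(i+1)/N]}f[x/\xi]$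 and $\overline{\mathsf{wp}}^N[x:\approx\mathtt{unif}_{[0,1]}](f)=\frac1N\sum_{i=0}^{N-1}\sup_{\xi\in[i/N,(i+1)/N]}f[x/\xi]$. Riemann-suitability. A function $h$ on $S$ with values in $\mathbb{R}\cup\{\pm\infty\}$ is locally bounded if $\sup_{\sigma\in K}|h(\sigma)|<\infty$ for all compact $K\subseteq S$. $f$ is Riemann-integrable on $[0,1]$ w.r.t. $x\in V$ if for all $\sigma\in S$ the function $[0,1]\to\mathbb{R},\ \xi\mapsto f(\sigma[x\mapsto\xi])$ is Riemann-integrable. A triple $(\mathcal{E},\mathcal{G},\mathcal{F})$ of a class $\mathcal{E}$ of locally bounded arithmetic expressions, a class $\mathcal{G}$ of guards and a class $\mathcal{F}\subseteq\mathbb{E}$ of locally bounded expectations is Riemann-suitable if every $f\in\mathcal{F}$ is Riemann-integrable on $[0,1]$ w.r.t. every $x\in V$, $\mathcal{F}$ contains the constants $0,1$, and: (i) for all $f\in\mathcal{F}$, $x\in V$, $[a,b]\subseteq[0,1]$: $\inf_{\xi\in[a,b]}f[x/\xi]\in\mathcal{F}$ and $\sup_{\xi\in[a,b]}f[x/\xi]\in\mathcal{F}$; (ii) for all $f\in\mathcal{F}$, $E\in\mathcal{E}$, $x\in V$: $f[x/E]\in\mathcal{F}$; (iii) for all $f,g\in\mathcal{F}$, $p\in[0,1]\cap\mathbb{Q}$: $p\cdot f+(1-p)\cdot g\in\mathcal{F}$; (iv) for all $f,g\in\mathcal{F}$, $\varphi\in\mathcal{G}$: $[\varphi]\cdot f+[\neg\varphi]\cdot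 g\in\mathcal{F}$. *)

(* Defs.v *)
From HB Require Import structures.
From mathcomp Require Import all_boot all_order all_algebra.
From mathcomp Require Import all_classical all_reals all_analysis.
From mathcomp Require Import measurable_realfun.

Set Implicit Arguments.
Unset Strict Implicit.
Unset Printing Implicit Defensive.

Import Order.TTheory GRing.Theory Num.Theory.
Import numFieldNormedType.Exports.

Local Open Scope classical_set_scope.
Local Open Scope ring_scope.

(* The half-line of nonnegative reals, with the topology induced from R and
   the corresponding Borel sigma-algebra. *)
Definition nnreal (R : realType) : Type := {nonneg R}.

Definition nnval (R : realType) (r : nnreal R) : R := (r : {nonneg R})%:num.

(* [nnr r] is r itself for 0 <= r, and it is only used for such r. *)
Definition nnr (R : realType) (r : R) : nnreal R := `|r|%:nng.

Lemma nnr_id (R : realType) (r : R) : 0 <= r -> nnval (nnr r) = r.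
Proof. by move=> r0; rewrite /nnval /nnr /= ger0_norm. Qed.

HB.instance Definition _ (R : realType) := Choice.copy (nnreal R) {nonneg R}.
HB.instance Definition _ (R : realType) := isPointed.Build (nnreal R) (nnr 0).
HB.instance Definition _ (R : realType) :=
  Topological.copy (nnreal R) (initial_topology (@nnval R)).
HB.instance Definition _ (R : realType) :=
  Measurable.copy (nnreal R) (g_sigma_algebraType (@open (nnreal R))).

(* States, with the product topology and its Borel sigma-algebra. *)
Definition state (V : finType) (R : realType) : Type := V -> nnreal R.

HB.instance Definition _ (V : finType) (R : realType) :=
  Choice.copy (state V R) (prod_topology (fun _ : V => nnreal R)).
HB.instance Definition _ (V : finType) (R : realType) :=
  isPointed.Build (state V R) (fun _ => nnr 0).
HB.instance Definition _ (V : finType) (R : realType) :=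
  Topological.copy (state V R) (prod_topology (fun _ : V => nnreal R)).
HB.instance Definition _ (V : finType) (R : realType) :=
  Measurable.copy (state V R) (g_sigma_algebraType (@open (state V R))).

Definition upd (V : finType) (R : realType) (s : state V R) (x : V)
    (r : nnreal R) : state V R :=
  fun y => if y == x then r else s y.

Section Programs.
Context (V : finType) (R : realType).
Local Notation S := (state V R).

Inductive prog : Type :=
| Skip
| Diverge
| Assign of V & (S -> nnreal R)
| Observe of (S -> bool)
| Unif of V
| Ite of (S -> bool) & prog & prog
| Choice of prog & rat & prog
| Seq of prog & prog.

Definition rat01 (p : rat) : Prop := 0 <= p <= 1.

Fixpoint pWhile (calE : set (S -> nnreal R)) (calG : set (S -> bool))
    (C : prog) : Prop :=
  match C with
  | Skip | Diverge | Unif _ => True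
  | Assign _ E => calE E
  | Observe phi => calG phi
  | Ite phi C1 C2 => [/\ calG phi, pWhile calE calG C1 & pWhile calE calG C2]
  | Choice C1 p C2 => [/\ rat01 p, pWhile calE calG C1 & pWhile calE calG C2]
  | Seq C1 C2 => pWhile calE calG C1 /\ pWhile calE calG C2
  end.

End Programs.

Arguments Skip {V R}.
Arguments Diverge {V R}.
Arguments Unif {V R}.

Section Transformers.
Context (V : finType) (R : realType).
Local Notation S := (state V R).
Local Open Scope ereal_scope.

Definition is_expectation : set (S -> \bar R) := [set f | forall s, 0 <= f s].

Definition expectation_meas : set (S -> \bar R) :=
  [set f | is_expectation f /\ measurable_fun [set: S] f].

Definition subst (f : S -> \bar R) (x : V) (E : S -> nnreal R) : S -> \bar R :=
  fun s => f (upd s x (E s)).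

(* [phi] . f + [not phi] . g *)
Definition mix_guard (phi : S -> bool) (f g : S -> \bar R) : S -> \bar R :=
  fun s => (phi s)%:R%:E * f s + (~~ phi s)%:R%:E * g s.

(* p . f + (1 - p) . g *)
Definition mix_prob (p : rat) (f g : S -> \bar R) : S -> \bar R :=
  fun s => (ratr p)%:E * f s + (1 - ratr p)%:E * g s.

Definition inf_subst (a b : R) (x : V) (f : S -> \bar R) : S -> \bar R :=
  fun s => ereal_inf [set f (upd s x (nnr xi)) | xi in `[a, b]].

Definition sup_subst (a b : R) (x : V) (f : S -> \bar R) : S -> \bar R :=
  fun s => ereal_sup [set f (upd s x (nnr xi)) | xi in `[a, b]].

Definition unif_int (x : V) (f : S -> \bar R) : S -> \bar R :=
  fun s => \int[lebesgue_measure]_(xi in `[0%R, 1%R]) f (upd s x (nnr xi)).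

Definition unif_lower (N : nat) (x : V) (f : S -> \bar R) : S -> \bar R :=
  fun s => (N%:R^-1)%:E *
    \sum_(i < N) inf_subst (i%:R / N%:R) (i.+1%:R / N%:R) x f s.

Definition unif_upper (N : nat) (x : V) (f : S -> \bar R) : S -> \bar R :=
  fun s => (N%:R^-1)%:E *
    \sum_(i < N) sup_subst (i%:R / N%:R) (i.+1%:R / N%:R) x f s.

(* The rules shared by the three transformers, which differ only in the
   treatment [U] of sampling. *)
Fixpoint wp_with (U : V -> (S -> \bar R) -> (S -> \bar R)) (C : prog V R)
    (f : S -> \bar R) : S -> \bar R :=
  match C with
  | Skip => f
  | Diverge => fun=> 0
  | Assign x E => subst f x E
  | Observe phi => fun s => (phi s)%:R%:E * f s
  | Unif x => U x f
  | Ite phi C1 C2 => mix_guard phi (wp_with U C1 f) (wp_with U C2 f)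
  | Choice C1 p C2 => mix_prob p (wp_with U C1 f) (wp_with U C2 f)
  | Seq C1 C2 => wp_with U C1 (wp_with U C2 f)
  end.

(* Lebesgue integrals being total in the library, [wp] is defined on all
   functions; it is meaningful on [expectation_meas]. *)
Definition wp := wp_with unif_int.
Definition lower_wp (N : nat) := wp_with (unif_lower N).
Definition upper_wp (N : nat) := wp_with (unif_upper N).

End Transformers.

Section RiemannSuitability.
Context (V : finType) (R : realType).
Local Notation S := (state V R).

Definition locally_bounded (h : S -> \bar R) : Prop :=
  forall K : set S, compact K -> (ereal_sup [set `|h s| | s in K] < +oo)%E.

(* Riemann sum of g for the partition whose points are those of a :: p
   (cf. [itv_partition]) and the tags xi_0, xi_1, ... *)
Definition riemann_sum (a b : R) (g : R -> R) (p : seq R) (xi : nat -> R) : R :=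
  \sum_(i < size p) g (xi i) * (nth b (a :: p) i.+1 - nth b (a :: p) i).

Definition riemann_integrable (a b : R) (g : R -> R) : Prop :=
  exists I : R, forall e : R, 0 < e -> exists2 d : R, 0 < d &
    forall (p : seq R) (xi : nat -> R),
      itv_partition a b p ->
      (forall i, (i < size p)%N ->
         nth b (a :: p) i <= xi i <= nth b (a :: p) i.+1 /\
         nth b (a :: p) i.+1 - nth b (a :: p) i < d) ->
      `|riemann_sum a b g p xi - I| < e.

Definition riemann_integrable_wrt (x : V) (f : S -> \bar R) : Prop :=
  forall s : S,
    (forall xi : R, 0 <= xi <= 1 -> f (upd s x (nnr xi)) \is a fin_num) /\
    riemann_integrable 0 1 (fun xi => fine (f (upd s x (nnr xi)))).

Record riemann_suitable (calE : set (S -> nnreal R)) (calG : set (S -> bool))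
    (calF : set (S -> \bar R)) : Prop := RiemannSuitable {
  suitable_E_meas : forall E, calE E -> measurable_fun setT E;
  suitable_E_bounded : forall E, calE E ->
    locally_bounded (fun s => (nnval (E s))%:E);
  suitable_G_meas : forall phi, calG phi -> measurable_fun setT phi;
  suitable_F_expectation : calF `<=` @is_expectation V R;
  suitable_F_bounded : forall f, calF f -> locally_bounded f;
  suitable_F_riemann : forall f x, calF f -> riemann_integrable_wrt x f;
  suitable_F_0 : calF (fun=> 0%E);
  suitable_F_1 : calF (fun=> 1%E);
  suitable_F_inf_sup : forall f x (a b : R), calF f ->
    0 <= a -> a <= b -> b <= 1 ->
    calF (inf_subst a b x f) /\ calF (sup_subst a b x f);
  suitable_F_subst : forall f E x, calF f -> calE E -> calF (subst f x E);
  suitable_F_prob : forall f g p, calF f -> calF g -> rat01 p ->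
    calF (mix_prob p f g);
  suitable_F_guard : forall f g phi, calF f -> calF g -> calG phi ->
    calF (mix_guard phi f g)
}.

End RiemannSuitability.

(* Main.v *)
Require Import Defs.
From mathcomp Require Import all_boot all_order all_algebra.
From mathcomp Require Import all_classical all_reals all_analysis.
From mathcomp Require Import measurable_realfun.
From mathcomp Require Import lra zify.

(* The Darboux transformers are compared with two Lebesgue transformers that
   make sense on all expectations, measurable or not: [wp], whose integral of
   a nonnegative function is the supremum over the simple functions below it,
   i.e. an inner integral, and [outer_wp], which samples with the outer
   integral. Inner integrals of bounded functions are continuous along
   nonincreasing sequences and outer integrals along nondecreasing ones, with
   no measurability assumption. Since post-expectations in F are Riemann
   integrable and F is closed under both Darboux transformers, induction on C
   shows that upper_wp (2 ^ k) decreases to [wp] and that lower_wp (2 ^ k)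
   increases to [outer_wp]; in a composition C1; C2 the approximants of C2 are
   taken to the limit under C1 by these continuity properties. As
   lower_wp N <= wp <= outer_wp, everything coincides. *)

Set Implicit Arguments.
Unset Strict Implicit.
Unset Printing Implicit Defensive.

Import Order.TTheory GRing.Theory Num.Theory.
Import numFieldNormedType.Exports.
Import HBNNSimple.

Local Open Scope classical_set_scope.
Local Open Scope ring_scope.

(** * Monotone sequences of extended reals and their limits *)

Section MonotoneLimits.
Context {R : realType}.
Implicit Types (u : (\bar R)^nat) (l : \bar R).
Local Open Scope ereal_scope.

Lemma nondecreasing_cvge_le u l n :
  nondecreasing_seq u -> u @ \oo --> l -> u n <= l.
Proof.
move=> /ereal_nondecreasing_cvgn ul /(cvg_unique _ ul) <- //.
by apply: ereal_sup_ubound; exists n.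
Qed.

Lemma nonincreasing_cvge_ge u l n :
  nonincreasing_seq u -> u @ \oo --> l -> l <= u n.
Proof.
move=> /ereal_nonincreasing_cvgn ul /(cvg_unique _ ul) <- //.
by apply: ereal_inf_lbound; exists n.
Qed.

End MonotoneLimits.

(** * Inner and outer integrals, and their continuity along monotone sequences *)

Section InnerOuterIntegrals.
Context {d : measure_display} {T : measurableType d} {R : realType}.
Context (mu : {measure set T -> \bar R}) (D : set T) (mD : measurable D).
Implicit Types f g h : T -> \bar R.
Local Open Scope ereal_scope.

(* The matching inner integral needs no definition: it is what the integral of
   the library computes on nonnegative functions that need not be
   measurable. *)
Definition upper_integral h : \bar R :=
  ereal_inf [set \int[mu]_(x in D) b x | b in
    [set b | measurable_fun D b /\ forall x, D x -> h x <= b x]].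

(** The integral of a nonnegative function is a supremum over the simple functions below it, and a
    larger function has more of them. *)
Lemma ge0_integral_mono f g : (forall x, D x -> 0 <= f x) ->
  (forall x, D x -> f x <= g x) ->
  \int[mu]_(x in D) f x <= \int[mu]_(x in D) g x.
Proof.
move=> f0 fg; rewrite !ge0_integralE//; last first.
  by move=> x Dx; exact: le_trans (f0 _ Dx) (fg _ Dx).
apply: le_ereal_sup => _ [a /= af <-]; exists a => //= x.
by apply: le_trans (af x) _; rewrite /patch; case: ifPn => // /set_mem /fg.
Qed.

Lemma integral_le_upper f : (forall x, D x -> 0 <= f x) ->
  \int[mu]_(x in D) f x <= upper_integral f.
Proof.
by move=> f0; apply: le_ereal_inf_tmp => _ [b /= [_ fb] <-];
  exact: ge0_integral_mono.
Qed.

Lemma upper_integral_mono f g : (forall x, D x -> f x <= g x) ->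
  upper_integral f <= upper_integral g.
Proof.
move=> fg; apply: ereal_inf_le_tmp => _ [b /= [mb gb] <-]; exists b => //.
by split => // x Dx; exact: le_trans (fg _ Dx) (gb _ Dx).
Qed.

Lemma upper_integral_ge0 f : (forall x, D x -> 0 <= f x) ->
  0 <= upper_integral f.
Proof.
by move=> f0; apply: le_trans (integral_le_upper f0); exact: integral_ge0.
Qed.

(** A Fatou argument: replace each [h_ n] by a measurable majorant whose integral exceeds the outer
    integral by at most [e], and apply Fatou to these majorants. *)
Lemma upper_integral_cvg (h_ : (T -> \bar R)^nat) h :
  (forall n x, D x -> 0 <= h_ n x) ->
  (forall x, D x -> nondecreasing_seq (h_ ^~ x)) ->
  (forall x, D x -> h_ n x @[n --> \oo] --> h x) ->
  upper_integral (h_ n) @[n --> \oo] --> upper_integral h.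
Proof.
move=> h0 hnd hh.
have und : nondecreasing_seq (fun n => upper_integral (h_ n)).
  by move=> m n mn; apply: upper_integral_mono => x Dx; exact: hnd.
have := ereal_nondecreasing_cvgn und; set L := ereal_sup _.
suff -> : L = upper_integral h by [].
apply/eqP; rewrite eq_le; apply/andP; split.
  apply: ge_ereal_sup => _ [n _ <-]; apply: upper_integral_mono => x Dx.
  exact: nondecreasing_cvge_le (hnd _ Dx) (hh _ Dx).
(* When the limit is finite, so are all the outer integrals, and majorants optimal up to [e]
   exist. *)
have [->|Ly] := eqVneq L +oo; first by rewrite leey.
have Lub n : upper_integral (h_ n) <= L by apply: ereal_sup_ubound; exists n.
apply/lee_addgt0Pr => e e0.
have ex n : exists b, [/\ measurable_fun D b, (forall x, D x -> h_ n x <= b x)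
    & \int[mu]_(x in D) b x <= L + e%:E].
  have fin : upper_integral (h_ n) \is a fin_num.
    rewrite ge0_fin_numE; first by rewrite (le_lt_trans (Lub n))// ltey.
    by apply: upper_integral_ge0 => x; exact: h0.
  have [_ [b /= [mb hb] <-] bl] := lb_ereal_inf_adherent e0 fin.
  exists b; split; [exact: mb|exact: hb|].
  apply: le_trans (ltW bl) _.
  exact: leeD2r (Lub n).
have {ex} [b bP] := choice ex.
have mb n : measurable_fun D (b n) by have [] := bP n.
have hb n x : D x -> h_ n x <= b n x by have [_ + _] := bP n; exact.
have b0 n x : D x -> 0 <= b n x.
  by move=> Dx; exact: le_trans (h0 n x Dx) (hb n x Dx).
have bL n : \int[mu]_(x in D) b n x <= L + e%:E by have [] := bP n.
(* The lower limit of the near-optimal majorants b_n is a majorant of h. *)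
apply: (@le_trans _ _ (\int[mu]_(x in D) limn_einf (b ^~ x))).
  apply: ereal_inf_lbound; exists (fun x => limn_einf (b ^~ x)) => //; split.
    have -> : (fun x => limn_einf (b ^~ x)) =
        (fun x => - limn_esup (fun n => - b n x)).
      by apply/funext => x.
    apply: measurableT_comp => //; apply: measurable_fun_limn_esup => n.
    exact: measurableT_comp.
  move=> x Dx; have [<- _] := cvg_limn_einf_sup (hh _ Dx).
  rewrite !limn_einf_lim; apply: lee_lim; [exact: is_cvg_einfs|
    exact: is_cvg_einfs|].
  apply: nearW => n; apply: le_ereal_inf_tmp => _ [m /= nm <-].
  by apply: le_trans (hb m x Dx); apply: ereal_inf_lbound; exists m.
apply: le_trans (fatou mu mD mb b0) _; rewrite limn_einf_lim.
apply: lime_le; first exact: is_cvg_einfs.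
apply: nearW => n; apply: le_trans (bL n).
by apply: ereal_inf_lbound; exists n => /=.
Qed.

(** Dually, each [h_ n] is replaced by a simple minorant optimal up to [e]. Dominated convergence
    takes the place of Fatou; the constant [c] is an integrable bound because [D] has finite
    measure. *)
Lemma integral_cvg_nonincreasing (h_ : (T -> \bar R)^nat) h (c : R) :
  mu D < +oo ->
  (forall n x, D x -> 0 <= h_ n x <= c%:E) ->
  (forall x, D x -> nonincreasing_seq (h_ ^~ x)) ->
  (forall x, D x -> h_ n x @[n --> \oo] --> h x) ->
  \int[mu]_(x in D) h_ n x @[n --> \oo] --> \int[mu]_(x in D) h x.
Proof.
move=> muD hc hni hh.
have h_0 n x : D x -> 0 <= h_ n x by move=> /(hc n) /andP[].
have h0 x : D x -> 0 <= h x.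
  move=> Dx; have /cvg_lim <- // := hh _ Dx.
  by apply: lime_ge; [exact: cvgP (hh _ Dx)|apply: nearW => n; exact: h_0].
have ini : nonincreasing_seq (fun n => \int[mu]_(x in D) h_ n x).
  move=> m n mn; apply: ge0_integral_mono => x Dx; first exact: h_0.
  exact: hni.
have := ereal_nonincreasing_cvgn ini; set L := ereal_inf _.
suff -> : L = \int[mu]_(x in D) h x by [].
apply/eqP; rewrite eq_le; apply/andP; split; last first.
  apply: le_ereal_inf_tmp => _ [n _ <-]; apply: ge0_integral_mono => // x Dx.
  exact: nonincreasing_cvge_ge (hni _ Dx) (hh _ Dx).
apply/lee_addgt0Pr => e e0.
have cfin : mu.-integrable D (cst c%:E).
  apply/integrableP; split; first exact: measurable_cst.
  by rewrite integral_cst//= lte_mul_pinfty.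
have ex n : exists a, [/\ measurable_fun D a,
    (forall x, D x -> 0 <= a x <= h_ n x)
    & L <= \int[mu]_(x in D) a x + e%:E].
  have fin : \int[mu]_(x in D) h_ n x \is a fin_num.
    rewrite ge0_fin_numE; last by apply: integral_ge0 => x; exact: h_0.
    apply: le_lt_trans (integrable_lty mD cfin).
    by apply: ge0_integral_mono => x /(hc n) /andP[].
  rewrite ge0_integralE in fin; last exact: h_0.
  have [_ [a /= ah <-] al] := ub_ereal_sup_adherent e0 fin.
  exists (EFin \o a); split.
  - exact/measurable_EFinP/measurable_funTS.
  - move=> x Dx; rewrite /= lee_fin fun_ge0/=.
    by have := ah x; rewrite /patch mem_set.
  (* The simple function lies below [h_ n] extended by 0, so it vanishes outside [D] and its
     integral over the whole space is its integral over [D]. *)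
  - have <- : sintegral mu a = \int[mu]_(x in D) (EFin \o a) x.
      rewrite [RHS]integral_nnsfun//; apply: eq_sintegral => x.
      rewrite [RHS]/patch; case: ifPn => // /negP xD; apply/eqP.
      have := ah x; rewrite /patch ifN; last exact/negP.
      by rewrite lee_fin eq_le => ->; rewrite fun_ge0.
    apply: (@le_trans _ _ (\int[mu]_(x in D) h_ n x)).
      by apply: ereal_inf_lbound; exists n.
    rewrite ge0_integralE; last exact: h_0.
    by rewrite -leeBlDr//; exact: ltW.
have {ex} [a aP] := choice ex.
have ma n : measurable_fun D (a n) by have [] := aP n.
have a0 n x : D x -> 0 <= a n x by have [_ + _] := aP n; move=> /[apply]/andP[].
have ah n x : D x -> a n x <= h_ n x.
  by have [_ + _] := aP n; move=> /[apply]/andP[].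
have aL n : L <= \int[mu]_(x in D) a n x + e%:E by have [] := aP n.
(* As h_ is nonincreasing, the tail suprema of the near-optimal minorants a_n
   still lie below h_n. *)
pose A n x := esups (a ^~ x) n.
have aA n x : a n x <= A n x by apply: ereal_sup_ubound; exists n => /=.
have Ah n x : D x -> A n x <= h_ n x.
  move=> Dx; apply: ge_ereal_sup => _ [m /= nm <-].
  by apply: le_trans (ah m x Dx) _; exact: hni.
have mA n : measurable_fun D (A n) by exact: measurable_fun_esups.
have A0 n x : D x -> 0 <= A n x.
  by move=> Dx; exact: le_trans (a0 n x Dx) (aA n x).
have cA x : A n x @[n --> \oo] --> limn_esup (a ^~ x).
  by rewrite limn_esup_lim; exact: is_cvg_esups.
have lh x : D x -> limn_esup (a ^~ x) <= h x.
  move=> Dx; have /cvg_lim <- // := cA x; have /cvg_lim <- // := hh x Dx.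
  apply: lee_lim; [exact: cvgP (cA x)|exact: cvgP (hh _ Dx)|].
  by apply: nearW => n; exact: Ah.
apply: (@le_trans _ _ (\int[mu]_(x in D) limn_esup (a ^~ x) + e%:E));
  last first.
  rewrite leeD2r//; apply: ge0_integral_mono => // x Dx.
  have /cvg_lim <- // := cA x.
  by apply: lime_ge; [exact: cvgP (cA x)|apply: nearW => n; exact: A0].
have dc : \int[mu]_(x in D) A n x @[n --> \oo] -->
    \int[mu]_(x in D) limn_esup (a ^~ x).
  apply: (dominated_cvg mD mA (fun x _ => cA x) _ cfin) => // n x Dx.
  rewrite gee0_abs; last exact: A0.
  by apply: le_trans (Ah n x Dx) _; have /andP[] := hc n x Dx.
rewrite -leeBlDr//; have /cvg_lim <- // := dc.
apply: lime_ge; first exact: cvgP dc.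
apply: nearW => n; rewrite leeBlDr//; apply: le_trans (aL n) _.
rewrite leeD2r//; apply: ge0_integral_mono => x Dx; first exact: a0.
exact: aA.
Qed.

End InnerOuterIntegrals.

(** * Darboux sums over uniform partitions of the unit interval *)

Section DarbouxSums.
Context {R : realType}.
Implicit Types (h : R -> \bar R) (N : nat).

(** Cells are closed, as in the sampling transformers, so neighbours share an endpoint. *)
Definition cell N (i : nat) : set R := `[i%:R / N%:R, i.+1%:R / N%:R].

Definition lower_sum N h : \bar R :=
  ((N%:R^-1)%:E * \sum_(i < N) ereal_inf [set h xi | xi in cell N i])%E.

Definition upper_sum N h : \bar R :=
  ((N%:R^-1)%:E * \sum_(i < N) ereal_sup [set h xi | xi in cell N i])%E.

Lemma cell_sub01 N i : (i < N)%N -> cell N i `<=` `[0, 1].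
Proof.
move=> iN x; rewrite /cell /= !in_itv/= => /andP[ix xi].
have N0 : 0 < N%:R :> R by rewrite ltr0n (leq_trans _ iN).
apply/andP; split; first by apply: le_trans ix; rewrite divr_ge0.
by apply: le_trans xi _; rewrite ler_pdivrMr// mul1r ler_nat.
Qed.

Lemma cell_left N i : cell N i (i%:R / N%:R).
Proof.
rewrite /cell /= in_itv/= lexx/=; rewrite ler_wpM2r ?invr_ge0// ler_nat.
exact: leqnSn.
Qed.

Lemma cell_cover N x : (0 < N)%N -> `[0, 1]%classic x ->
  exists2 i : 'I_N, true & cell N i x.
Proof.
move=> N0; rewrite /= in_itv/= => /andP[x0 x1].
have NR : 0 < N%:R :> R by rewrite ltr0n.
(* Truncating [x * N] gives the index of a cell, except at 1, where it would give [N]; that point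
   goes into the last cell. *)
have [xE|xN1] := eqVneq x 1.
  have N1 : (N.-1 < N)%N by rewrite ltn_predL.
  exists (Ordinal N1) => //; rewrite /cell /= in_itv/= prednK//.
  by rewrite divff ?gt_eqF// x1 xE andbT ler_pdivrMr// mul1r ler_nat leq_pred.
have /truncn_itv : 0 <= x * N%:R by rewrite mulr_ge0.
move=> /andP[t1 t2]; have tN : (Num.trunc (x * N%:R) < N)%N.
  rewrite -(ltr_nat R); apply: le_lt_trans t1 _.
  by rewrite -[ltRHS]mul1r ltr_pM2r// lt_neqAle xN1.
exists (Ordinal tN) => //; rewrite /cell /= in_itv/=.
by rewrite ler_pdivrMr// t1 ler_pdivlMr// ltW.
Qed.

(** The bounds [b0] and [b1] are free because the lower sum is compared using half-open cells and
    the upper sum using closed ones. *)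
Lemma lebesgue_measure_cell N i (b0 b1 : bool) : (i < N)%N ->
  lebesgue_measure
    ([set` Interval (BSide b0 (i%:R / N%:R)) (BSide b1 (i.+1%:R / N%:R))]
       : set R) = (N%:R^-1)%:E.
Proof.
move=> iN; have N0 : 0 < N%:R :> R by rewrite ltr0n (leq_trans _ iN).
rewrite lebesgue_measure_itv/= lte_fin ltr_pM2r ?invr_gt0// ltr_nat ltnSn.
by rewrite -EFinB -mulrBl -natrB ?leqnSn// subSnn mul1r.
Qed.

Lemma lower_sum_le_integral N h : (0 < N)%N -> (forall x, 0 <= h x)%E ->
  (lower_sum N h <= \int[lebesgue_measure]_(x in `[0%R, 1%R]) h x)%E.
Proof.
move=> N0 h0; pose I i := ereal_inf [set h xi | xi in cell N i].
(* The lower sum is the integral of a step function on half-open cells. These are disjoint, so at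
   most one term is nonzero at each point and the step function stays below [h]; at points in no
   half-open cell, such as 1, it is 0. *)
have I0 i : (0 <= I i)%E by apply: le_ereal_inf_tmp => _ [x _ <-].
pose J i : set R := `[i%:R / N%:R, i.+1%:R / N%:R[%classic.
have JC i : J i `<=` cell N i.
  by move=> x; rewrite /J /cell /= !in_itv/= => /andP[-> /ltW ->].
have disj x (i j : nat) : J i x -> J j x -> (i <= j)%N.
  rewrite /J /= !in_itv/= => /andP[ix _] /andP[_ xj].
  have := le_lt_trans ix xj; rewrite ltr_pM2r ?invr_gt0 ?ltr0n// ltr_nat.
  by rewrite ltnS.
pose a x := (\sum_(i < N) I i * (\1_(J i) x)%:E)%E.
have mJ i : measurable (J i : set (measurableTypeR R)).
  exact: measurable_itv.
have mI i : measurable_fun (`[0, 1]%classic : set (measurableTypeR R))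
    (fun x : measurableTypeR R => (\1_(J i) x : R)%:E).
  exact/measurable_EFinP/measurable_indic.
have -> : lower_sum N h = (\int[lebesgue_measure]_(x in `[0%R, 1%R]) a x)%E.
  rewrite ge0_integral_sum//; first last.
  - by move=> i x _; rewrite mule_ge0.
  - by move=> i; apply: measurable_funeM; exact: mI.
  rewrite /lower_sum ge0_sume_distrr => [|i _]; last exact: I0.
  apply: eq_bigr => i _.
  rewrite ge0_integralZl//.
  rewrite integral_indic// setIidl; last first.
    by apply: subset_trans (JC i) _; exact: cell_sub01.
  by rewrite muleC; congr mule; exact/esym/lebesgue_measure_cell.
apply: ge0_integral_mono => x _.
  by apply: sume_ge0 => i _; rewrite mule_ge0.
rewrite /a; have [[i Ji]|nJ] := pselect (exists i : 'I_N, J i x).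
  rewrite (bigD1 i)//= big1 ?adde0; last first.
    move=> j ji; rewrite indicE memNset ?mule0// => Jj.
    case/eqP: ji; apply/val_inj/eqP; rewrite eqn_leq.
    by rewrite (disj x j i Jj Ji) (disj x i j Ji Jj).
  rewrite indicE mem_set// mule1; apply: ereal_inf_lbound; exists x => //.
  exact: JC.
rewrite big1// => i _; rewrite indicE memNset ?mule0// => Ji.
by apply: nJ; exists i.
Qed.

Lemma upper_integral_le_upper_sum N h : (0 < N)%N -> (forall x, 0 <= h x)%E ->
  (upper_integral lebesgue_measure `[0%R, 1%R] h <= upper_sum N h)%E.
Proof.
move=> N0 h0; pose M i := ereal_sup [set h xi | xi in cell N i].
have M0 i : (0 <= M i)%E.
  apply: le_trans (h0 (i%:R / N%:R)) _; apply: ereal_sup_ubound.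
  by exists (i%:R / N%:R) => //; exact: cell_left.
(* Closed cells do here: they cover the whole interval, and an overlap only enlarges the majorant,
   without changing its integral. *)
pose a x := (\sum_(i < N) M i * (\1_(cell N i) x)%:E)%E.
have mJ i : measurable (cell N i : set (measurableTypeR R)).
  exact: measurable_itv.
have mI i : measurable_fun (`[0, 1]%classic : set (measurableTypeR R))
    (fun x : measurableTypeR R => (\1_(cell N i) x : R)%:E).
  exact/measurable_EFinP/measurable_indic.
have -> : upper_sum N h = (\int[lebesgue_measure]_(x in `[0%R, 1%R]) a x)%E.
  rewrite ge0_integral_sum//; first last.
  - by move=> i x _; rewrite mule_ge0.
  - by move=> i; apply: measurable_funeM; exact: mI.
  rewrite /upper_sum ge0_sume_distrr => [|i _]; last exact: M0.
  apply: eq_bigr => i _.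
  rewrite ge0_integralZl//.
  rewrite integral_indic// setIidl; last exact: cell_sub01.
  by rewrite muleC; congr mule; exact/esym/lebesgue_measure_cell.
apply: ereal_inf_lbound; exists a => //; split.
  by apply: emeasurable_fun_sum => i; apply: measurable_funeM; exact: mI.
move=> x /(cell_cover N0)[i _ ix].
rewrite /a (bigD1 i)//= indicE mem_set// mule1.
apply: (@le_trans _ _ (M i)); first by apply: ereal_sup_ubound; exists x.
by rewrite leeDl// sume_ge0// => j _; rewrite mule_ge0.
Qed.

Lemma cell_double N i (b : bool) : cell (N * 2) (i * 2 + b) `<=` cell N i.
Proof.
have [->|N0] := posnP N.
  by rewrite /cell mul0n invr0 !mulr0.
have b2 : ((i * 2 + b).+1 <= i.+1 * 2)%N by case: b; lia.
move=> x; rewrite /cell /= !in_itv/= => /andP[ix xi].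
have e (k : nat) : k%:R / N%:R = (k * 2)%:R / (N * 2)%:R :> R.
  by rewrite !natrM -mulf_div divff ?mulr1// pnatr_eq0.
have N2 : 0 <= (N * 2)%:R^-1 :> R by rewrite invr_ge0.
apply/andP; split.
  by apply: le_trans ix; rewrite e ler_wpM2r// ler_nat leq_addr.
by apply: le_trans xi _; rewrite e ler_wpM2r// ler_nat.
Qed.

Lemma sum_double N (F : nat -> \bar R) :
  (\sum_(i < N * 2) F i = \sum_(i < N) (F (i * 2)%N + F (i * 2 + 1)%N))%E.
Proof.
rewrite -(big_mkord xpredT F) big_nat_mul big_mkord; apply: eq_bigr => i _.
do 2 (rewrite big_ltn; last by lia).
by rewrite big_geq ?[LHS]/= ?addr0 ?addn1//; lia.
Qed.

Lemma invr_muln_double N (x : \bar R) :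
  ((N%:R^-1)%:E * x = ((N * 2)%:R^-1)%:E * (x + x))%E.
Proof.
by rewrite -mule2n -mule_natl muleA -EFinM natrM invfM -mulrA mulVf ?mulr1.
Qed.

(** Each cell splits into two halves, over which the supremum can only drop. Successive [N] do not
    refine one another, whence the powers of two below. *)
Lemma upper_sum_double N h : (upper_sum (N * 2) h <= upper_sum N h)%E.
Proof.
rewrite /upper_sum (invr_muln_double N) lee_wpmul2l ?lee_fin ?invr_ge0//.
rewrite (sum_double _ (fun i => ereal_sup [set h xi | xi in cell (N * 2) i])).
rewrite -big_split/=; apply: lee_sum => i _.
by apply: leeD; apply: ereal_sup_le; apply: image_subset;
  [rewrite -[X in cell _ X]addn0; exact: (@cell_double N i false)|
   exact: (@cell_double N i true)].
Qed.

Lemma lower_sum_double N h : (lower_sum N h <= lower_sum (N * 2) h)%E.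
Proof.
rewrite /lower_sum (invr_muln_double N) lee_wpmul2l ?lee_fin ?invr_ge0//.
rewrite (sum_double _ (fun i => ereal_inf [set h xi | xi in cell (N * 2) i])).
rewrite -big_split/=; apply: lee_sum => i _.
by apply: leeD; apply: ereal_inf_le_tmp; apply: image_subset;
  [rewrite -[X in cell _ X]addn0; exact: (@cell_double N i false)|
   exact: (@cell_double N i true)].
Qed.

(** [itv_partition] lists the points after the left endpoint, hence the shift by one and the absence
    of 0. *)
Definition uniform_partition N : seq R := mkseq (fun i => i.+1%:R / N%:R) N.

Lemma nth_uniform_partition N i : (0 < N)%N -> (i <= N)%N ->
  nth 1 (0 :: uniform_partition N) i = i%:R / N%:R.
Proof. by move=> N0; case: i => [|i] iN; rewrite ?mul0r//= nth_mkseq. Qed.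

Lemma uniform_itv_partition N : (0 < N)%N ->
  itv_partition 0 1 (uniform_partition N).
Proof.
move=> N0; have NR : 0 < N%:R :> R by rewrite ltr0n.
split.
  apply/(pathP 1) => i; rewrite size_mkseq => iN.
  rewrite nth_uniform_partition ?(ltnW iN)// nth_mkseq//.
  by rewrite ltr_pM2r ?invr_gt0// ltr_nat.
rewrite (last_nth 1) size_mkseq nth_uniform_partition// divff//.
by rewrite gt_eqF.
Qed.

Lemma riemann_sum_uniform N (xi : nat -> R) (f : R -> R) : (0 < N)%N ->
  riemann_sum 0 1 f (uniform_partition N) xi =
  N%:R^-1 * \sum_(i < N) f (xi i).
Proof.
move=> N0; rewrite /riemann_sum.
rewrite -(big_mkord xpredT (fun i => f (xi i) *
  (nth 1 (0 :: uniform_partition N) i.+1 -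
   nth 1 (0 :: uniform_partition N) i))) size_mkseq big_mkord mulr_sumr.
apply: eq_bigr => i _; rewrite !nth_uniform_partition// 1?ltnW//.
by rewrite -mulrBl -natrB ?leqnSn// subSnn mul1r mulrC.
Qed.

(** Tags that almost attain the suprema, respectively the infima, turn the two Darboux sums into
    Riemann sums up to a small error, and all Riemann sums of a fine enough partition are close to
    [I]. *)
Lemma riemann_darboux h (c : R) :
  (forall x : R, `[0%R, 1%R]%classic x -> 0 <= h x <= c%:E)%E ->
  riemann_integrable 0 1 (fun x => fine (h x)) ->
  forall e : R, 0 < e -> exists N0 : nat, forall N, (N0 <= N)%N -> (0 < N)%N ->
    (upper_sum N h <= lower_sum N h + e%:E)%E.
Proof.
(* Four errors add up to [e]: the choice of tags and the distance to [I], each for the upper and for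
   the lower sum. *)
move=> hc [I hI] e e0; have e4 : 0 < e / 4 by lra.
have [d d0 {}hI] := hI _ e4.
exists (Num.trunc d^-1).+1 => N dN N0.
have NR : 0 < N%:R :> R by rewrite ltr0n.
have Nd : N%:R^-1 < d.
  rewrite -[ltRHS]invrK ltf_pV2 ?posrE ?invr_gt0//.
  have /truncn_itv/andP[_ ] : 0 <= d^-1 by rewrite invr_ge0 ltW.
  by move=> /lt_le_trans; apply; rewrite ler_nat.
have hfin x : `[0, 1]%classic x -> h x \is a fin_num.
  move=> /hc /andP[h0 hc']; rewrite ge0_fin_numE//.
  by apply: le_lt_trans hc' _; rewrite ltry.
have RS (xi : nat -> R) : (forall i, (i < N)%N -> cell N i (xi i)) ->
    `|N%:R^-1 * (\sum_(i < N) fine (h (xi i))) - I| < e / 4.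
  move=> xiC; rewrite -(riemann_sum_uniform _ (fine \o h))//; apply: hI.
    exact: uniform_itv_partition.
  move=> i; rewrite size_mkseq => iN.
  rewrite !nth_uniform_partition// 1?ltnW//.
  split; first by have := xiC i iN; rewrite /cell /= in_itv.
  by rewrite -mulrBl -natrB ?leqnSn// subSnn mul1r.
(* The premise on [i] makes the statement hold for all naturals, so that one tag function can be
   chosen; 0 is a dummy value beyond [N]. *)
have exM (i : nat) : exists x : R, (i < N)%N ->
    cell N i x /\ (ereal_sup [set h x | x in cell N i] <= h x + (e / 4)%:E)%E.
  have [iN|] := ltnP i N; last by exists 0.
  have fin : ereal_sup [set h x | x in cell N i] \is a fin_num.
    have iC := cell_left N i; have /andP[h0 _] := hc _ (cell_sub01 iN iC).
    rewrite ge0_fin_numE; last first.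
      by apply: le_trans h0 _; apply: ereal_sup_ubound; exists (i%:R / N%:R).
    apply: (@le_lt_trans _ _ c%:E); last by rewrite ltry.
    by apply: ge_ereal_sup => _ [x /(cell_sub01 iN)/hc/andP[_ ?] <-].
  have [_ [x Cx <-] /ltW hx] := ub_ereal_sup_adherent e4 fin.
  by exists x => _; split => //; rewrite -leeBlDr.
have exm (i : nat) : exists x : R, (i < N)%N ->
    cell N i x /\ (h x <= ereal_inf [set h x | x in cell N i] + (e / 4)%:E)%E.
  have [iN|] := ltnP i N; last by exists 0.
  have fin : ereal_inf [set h x | x in cell N i] \is a fin_num.
    have iC := cell_left N i; have /hfin := cell_sub01 iN iC.
    rewrite !ge0_fin_numE; first last.
    - by have /andP[] := hc _ (cell_sub01 iN iC).
    - by apply: le_ereal_inf_tmp => _ [x /(cell_sub01 iN)/hc/andP[? _] <-].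
    move=> /(le_lt_trans _); apply; apply: ereal_inf_lbound.
    by exists (i%:R / N%:R).
  have [_ [x Cx <-] /ltW hx] := lb_ereal_inf_adherent e4 fin.
  by exists x => _; split.
have {exM} [t tP] := choice exM; have {exm} [u uP] := choice exm.
have tC i (iN : (i < N)%N) : cell N i (t i) by have [] := tP i iN.
have uC i (iN : (i < N)%N) : cell N i (u i) by have [] := uP i iN.
have sumcst : \sum_(i < N) (e / 4) = (e / 4) * N%:R.
  by rewrite sumr_const card_ord mulr_natr.
have up : (upper_sum N h <=
    (N%:R^-1 * (\sum_(i < N) fine (h (t i))) + e / 4)%:E)%E.
  rewrite -[e / 4](mulKf (lt0r_neq0 NR)) [N%:R * _]mulrC -sumcst -mulrDr.
  rewrite -big_split/= EFinM -sumEFin lee_wpmul2l ?lee_fin ?invr_ge0//.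
  apply: lee_sum => i _; have [/(cell_sub01 (ltn_ord i))/hfin hf] :=
    tP i (ltn_ord i).
  by rewrite EFinD fineK.
have low : ((N%:R^-1 * (\sum_(i < N) fine (h (u i))) - e / 4)%:E <=
    lower_sum N h)%E.
  rewrite -[e / 4](mulKf (lt0r_neq0 NR)) [N%:R * _]mulrC -sumcst -mulrBr.
  rewrite -sumrB EFinM -sumEFin lee_wpmul2l ?lee_fin ?invr_ge0//.
  apply: lee_sum => i _; have [/(cell_sub01 (ltn_ord i))/hfin hf] :=
    uP i (ltn_ord i).
  by rewrite EFinB fineK// leeBlDr.
apply: le_trans up _; apply: le_trans (leeD2r e%:E low).
rewrite -EFinD lee_fin; have := RS _ tC; have := RS _ uC.
by rewrite !ltr_norml => /andP[? ?] /andP[? ?]; lra.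
Qed.

(** The inner integral lies between the lower and the upper sums, whose gap vanishes by
    [riemann_darboux]. The outer integral is squeezed in the same way in [lower_sum_cvg]. *)
Lemma upper_sum_cvg h (c : R) : (forall x, 0 <= h x)%E ->
  (forall x : R, `[0%R, 1%R]%classic x -> h x <= c%:E)%E ->
  riemann_integrable 0 1 (fun x => fine (h x)) ->
  (upper_sum (2 ^ k) h @[k --> \oo] -->
     \int[lebesgue_measure]_(x in `[0%R, 1%R]) h x)%E.
Proof.
move=> h0 hc hR.
have ni : nonincreasing_seq (fun k => upper_sum (2 ^ k) h).
  by apply/nonincreasing_seqP => k; rewrite expnSr; exact: upper_sum_double.
have := ereal_nonincreasing_cvgn ni; set L := ereal_inf _.
suff -> : L = (\int[lebesgue_measure]_(x in `[0%R, 1%R]) h x)%E by [].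
apply/eqP; rewrite eq_le; apply/andP; split.
  apply/lee_addgt0Pr => e e0.
  have [|N0 hN] := @riemann_darboux h c _ hR e e0.
    by move=> x x01; rewrite h0/= hc.
  (* The threshold [N0] itself serves as the exponent. *)
  have N2 : (N0 <= 2 ^ N0)%N by rewrite ltnW// ltn_expl.
  have N1 : (0 < 2 ^ N0)%N by rewrite expn_gt0.
  apply: (@le_trans _ _ (upper_sum (2 ^ N0) h)).
    by apply: ereal_inf_lbound; exists N0.
  apply: le_trans (hN _ N2 N1) _.
  by rewrite leeD2r//; exact: lower_sum_le_integral.
apply: le_ereal_inf_tmp => _ [k _ <-].
have k0 : (0 < 2 ^ k)%N by rewrite expn_gt0.
apply: le_trans (upper_integral_le_upper_sum k0 h0).
by apply: integral_le_upper => //; exact: measurable_itv.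
Qed.

Lemma lower_sum_cvg h (c : R) : (forall x, 0 <= h x)%E ->
  (forall x : R, `[0%R, 1%R]%classic x -> h x <= c%:E)%E ->
  riemann_integrable 0 1 (fun x => fine (h x)) ->
  lower_sum (2 ^ k) h @[k --> \oo] -->
     upper_integral lebesgue_measure `[0, 1] h.
Proof.
move=> h0 hc hR.
have nd : nondecreasing_seq (fun k => lower_sum (2 ^ k) h).
  by apply/nondecreasing_seqP => k; rewrite expnSr; exact: lower_sum_double.
have := ereal_nondecreasing_cvgn nd; set L := ereal_sup _.
suff -> : L = upper_integral lebesgue_measure `[0, 1] h by [].
apply/eqP; rewrite eq_le; apply/andP; split.
  apply: ge_ereal_sup => _ [k _ <-].
  have k0 : (0 < 2 ^ k)%N by rewrite expn_gt0.
  apply: le_trans (lower_sum_le_integral k0 h0) _.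
  by apply: integral_le_upper => //; exact: measurable_itv.
apply/lee_addgt0Pr => e e0.
have [|N0 hN] := @riemann_darboux h c _ hR e e0.
  by move=> x x01; rewrite h0/= hc.
have N2 : (N0 <= 2 ^ N0)%N by rewrite ltnW// ltn_expl.
have N1 : (0 < 2 ^ N0)%N by rewrite expn_gt0.
apply: le_trans (upper_integral_le_upper_sum N1 h0) _.
apply: le_trans (hN _ N2 N1) _.
by rewrite leeD2r//; apply: ereal_sup_ubound; exists N0.
Qed.

End DarbouxSums.

(** * Monotonicity and nonnegativity of Darboux sums *)

Section DarbouxMonotone.
Context {R : realType}.
Implicit Types (g h : R -> \bar R) (N : nat).
Local Open Scope ereal_scope.

Lemma upper_sum_mono N g h : (forall x, g x <= h x) ->
  upper_sum N g <= upper_sum N h.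
Proof.
move=> gh; rewrite lee_wpmul2l ?lee_fin ?invr_ge0//; apply: lee_sum => i _.
apply: ge_ereal_sup => _ [x ix <-]; apply: le_trans (gh x) _.
by apply: ereal_sup_ubound; exists x.
Qed.

Lemma lower_sum_mono N g h : (forall x, g x <= h x) ->
  lower_sum N g <= lower_sum N h.
Proof.
move=> gh; rewrite lee_wpmul2l ?lee_fin ?invr_ge0//; apply: lee_sum => i _.
apply: le_ereal_inf_tmp => _ [x ix <-]; apply: le_trans (gh x).
by apply: ereal_inf_lbound; exists x.
Qed.

Lemma lower_sum_ge0 N h : (forall x, 0 <= h x) -> 0 <= lower_sum N h.
Proof.
move=> h0; rewrite mule_ge0 ?lee_fin ?invr_ge0//; apply: sume_ge0 => i _.
by apply: le_ereal_inf_tmp => _ [x _ <-].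
Qed.

Lemma upper_sum_ge0 N h : (forall x, 0 <= h x) -> 0 <= upper_sum N h.
Proof.
move=> h0; rewrite mule_ge0 ?lee_fin ?invr_ge0//; apply: sume_ge0 => i _.
apply: le_trans (h0 (i%:R / N%:R)%R) _; apply: ereal_sup_ubound.
by exists (i%:R / N%:R)%R => //; exact: cell_left.
Qed.

End DarbouxMonotone.

(** * Inductions on programs, for an arbitrary treatment of sampling *)

Section GenericTransformers.
Context {V : finType} {R : realType}.
Local Notation S := (state V R).
Implicit Types (U : V -> (S -> \bar R) -> (S -> \bar R)) (f g : S -> \bar R).
Context {calE : set (S -> nnreal R)} {calG : set (S -> bool)}.
Local Open Scope ereal_scope.

Lemma rat01_ratr p : rat01 p ->
  (0 <= ratr p :> R)%R /\ (0 <= 1 - ratr p :> R)%R.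
Proof.
move=> /andP[p0 p1]; rewrite ler0q; split => //.
by rewrite subr_ge0 -[leRHS](rmorph1 (@ratr R)) ler_rat.
Qed.

Lemma wp_with_ge0 U :
  (forall x f, is_expectation f -> is_expectation (U x f)) ->
  forall C f, pWhile calE calG C -> is_expectation f ->
  is_expectation (wp_with U C f).
Proof.
move=> U0; elim => [||x E|phi|x|phi C1 IH1 C2 IH2|C1 IH1 p C2 IH2|C1 IH1 C2 IH2]
  f //= hC f0.
- by [].
- by move=> s; exact: f0.
- by move=> s; rewrite mule_ge0// lee_fin.
- exact: U0.
- case: hC => _ h1 h2 s.
  by rewrite adde_ge0// mule_ge0 ?lee_fin//; [exact: IH1|exact: IH2].
- case: hC => /rat01_ratr[p0 p1] h1 h2 s.
  by rewrite adde_ge0// mule_ge0 ?lee_fin//; [exact: IH1|exact: IH2].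
- by case: hC => h1 h2; apply: IH1 => //; exact: IH2.
Qed.

(** Letting the sampling and the post-expectation grow together yields monotonicity ([U] equal to
    [U']) and the comparison of different transformers from one induction. *)
Lemma wp_with_le U U' :
  (forall x f, is_expectation f -> is_expectation (U x f)) ->
  (forall x f g, is_expectation f -> (forall s, f s <= g s) ->
    forall s, U x f s <= U' x g s) ->
  forall C f g, pWhile calE calG C -> is_expectation f ->
  (forall s, f s <= g s) -> forall s, wp_with U C f s <= wp_with U' C g s.
Proof.
move=> U0 UU'.
elim => [||x E|phi|x|phi C1 IH1 C2 IH2|C1 IH1 p C2 IH2|C1 IH1 C2 IH2]
  f g //= hC f0 fg s.
- exact: fg.
- by rewrite lee_wpmul2l// lee_fin.
- exact: UU'.
- case: hC => _ h1 h2.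
  by rewrite leeD// lee_wpmul2l ?lee_fin//; [exact: IH1|exact: IH2].
- case: hC => /rat01_ratr[p0 p1] h1 h2.
  by rewrite leeD// lee_wpmul2l ?lee_fin//; [exact: IH1|exact: IH2].
- case: hC => h1 h2; apply: IH1 => //; first exact: wp_with_ge0.
  exact: IH2.
Qed.

(** Nonnegativity excludes a sum of opposite infinities in the limit. *)
Lemma cvge_lincomb (a b : R) (u v : (\bar R)^nat) (l m : \bar R) :
  (0 <= a)%R -> (0 <= b)%R -> (forall n, 0 <= u n) -> (forall n, 0 <= v n) ->
  u n @[n --> \oo] --> l -> v n @[n --> \oo] --> m ->
  a%:E * u n + b%:E * v n @[n --> \oo] --> a%:E * l + b%:E * m.
Proof.
move=> a0 b0 u0 v0 ul vm.
have l0 : 0 <= l by apply: (cvge_to_ge ul); exact: nearW.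
have m0 : 0 <= m by apply: (cvge_to_ge vm); exact: nearW.
apply: cvgeD; [|exact: cvgeZl|exact: cvgeZl].
by apply: ge0_adde_def; rewrite inE mule_ge0.
Qed.

(** [Q] is the invariant under which sampling commutes with limits (monotonicity, domination). It
    must be preserved by programs so that in [C1; C2] the images under [C2] can be fed to [C1]. *)
Lemma wp_with_cvg U (Q : (nat -> S -> \bar R) -> Prop) :
  (forall u n, Q u -> is_expectation (u n)) ->
  (forall C u, pWhile calE calG C -> Q u -> Q (fun n => wp_with U C (u n))) ->
  (forall x u f, Q u -> (forall s, u n s @[n --> \oo] --> f s) ->
    forall s, U x (u n) s @[n --> \oo] --> U x f s) ->
  forall C u f, pWhile calE calG C -> Q u ->
    (forall s, u n s @[n --> \oo] --> f s) ->
    forall s, wp_with U C (u n) s @[n --> \oo] --> wp_with U C f s.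
Proof.
move=> Q0 QC QU.
elim => [||x E|phi|x|phi C1 IH1 C2 IH2|C1 IH1 p C2 IH2|C1 IH1 C2 IH2]
  u f hC Qu uf s.
- exact: uf.
- exact: cvg_cst.
- exact: uf.
- exact: cvgeZl.
- exact: QU.
- case: hC => _ h1 h2; apply: cvge_lincomb => //.
  + by move=> n; exact: (Q0 _ n (QC _ _ h1 Qu)).
  + by move=> n; exact: (Q0 _ n (QC _ _ h2 Qu)).
  + exact: IH1.
  + exact: IH2.
- case: hC => /rat01_ratr[p0 p1] h1 h2; apply: cvge_lincomb => //.
  + by move=> n; exact: (Q0 _ n (QC _ _ h1 Qu)).
  + by move=> n; exact: (Q0 _ n (QC _ _ h2 Qu)).
  + exact: IH1.
  + exact: IH2.
- case: hC => h1 h2; apply: IH1 => //; first exact: QC.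
  by move=> t; exact: IH2.
Qed.

(** Composition is left as a premise: the approximations of both components move with [k], and the
    limit under [C2] is not known to lie in [F], so the hypothesis on [C1] does not apply to it. *)
Lemma wp_with_approx (A : nat -> V -> (S -> \bar R) -> S -> \bar R) U
    (F : set (S -> \bar R)) :
  F `<=` @is_expectation V R ->
  (forall k x f, is_expectation f -> is_expectation (A k x f)) ->
  (forall f E x, F f -> calE E -> F (subst f x E)) ->
  (forall x f, F f -> forall s, A k x f s @[k --> \oo] --> U x f s) ->
  (forall C1 C2 f, pWhile calE calG C1 -> pWhile calE calG C2 -> F f ->
    (forall g s, F g ->
      wp_with (A k) C1 g s @[k --> \oo] --> wp_with U C1 g s) ->
    (forall s, wp_with (A k) C2 f s @[k --> \oo] --> wp_with U C2 f s) ->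
    forall s, wp_with (A k) C1 (wp_with (A k) C2 f) s @[k --> \oo] -->
      wp_with U C1 (wp_with U C2 f) s) ->
  forall C f, pWhile calE calG C -> F f ->
    forall s, wp_with (A k) C f s @[k --> \oo] --> wp_with U C f s.
Proof.
move=> F0 A0 Fsubst FU Fseq.
elim => [||x E|phi|x|phi C1 IH1 C2 IH2|C1 IH1 p C2 IH2|C1 IH1 C2 IH2]
  f hC Ff s; try exact: cvg_cst.
- exact: FU.
- case: hC => _ h1 h2; apply: cvge_lincomb => //.
  + by move=> n; apply: wp_with_ge0 h1 (F0 _ Ff) s; exact: A0.
  + by move=> n; apply: wp_with_ge0 h2 (F0 _ Ff) s; exact: A0.
  + exact: IH1.
  + exact: IH2.
- case: hC => /rat01_ratr[p0 p1] h1 h2; apply: cvge_lincomb => //.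
  + by move=> n; apply: wp_with_ge0 h1 (F0 _ Ff) s; exact: A0.
  + by move=> n; apply: wp_with_ge0 h2 (F0 _ Ff) s; exact: A0.
  + exact: IH1.
  + exact: IH2.
- case: hC => h1 h2; apply: Fseq => //; first by move=> g t Fg; exact: IH1.
  by move=> t; exact: IH2.
Qed.

Lemma wp_with_closed U (F : set (S -> \bar R)) :
  riemann_suitable calE calG F -> (forall x f, F f -> F (U x f)) ->
  forall C f, pWhile calE calG C -> F f -> F (wp_with U C f).
Proof.
move=> suit FU.
elim => [||x E|phi|x|phi C1 IH1 C2 IH2|C1 IH1 p C2 IH2|C1 IH1 C2 IH2]
  f //= hC Ff.
- exact: suitable_F_0 suit.
- exact: suitable_F_subst suit _ _ _ _ _.
(* An observation is a branching whose other branch yields 0, a member of [F]. *)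
- have -> : (fun s => (phi s)%:R%:E * f s) = mix_guard phi f (fun=> 0).
    by apply/funext => s; rewrite /mix_guard mule0 adde0.
  by apply: (suitable_F_guard suit) => //; exact: suitable_F_0 suit.
- exact: FU.
- case: hC => hphi h1 h2.
  by apply: (suitable_F_guard suit) => //; [exact: IH1|exact: IH2].
- case: hC => hp h1 h2.
  by apply: (suitable_F_prob suit) => //; [exact: IH1|exact: IH2].
- by case: hC => h1 h2; apply: IH1 => //; exact: IH2.
Qed.

End GenericTransformers.

(** * Convergence of the transformers for a Riemann-suitable triple *)

Section RiemannSuitable.
Context {V : finType} {R : realType}.
Local Notation S := (state V R).
Implicit Types (f g : S -> \bar R) (u : nat -> S -> \bar R).
Context {calE : set (S -> nnreal R)} {calG : set (S -> bool)}.
Context {calF : set (S -> \bar R)}.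
Context (suitable : riemann_suitable calE calG calF).
Local Open Scope ereal_scope.

(* [unif_lower N x f s] and [unif_upper N x f s] are convertible to the Darboux
   sums of [section_at f x s]. *)
Definition section_at f x s (xi : R) : \bar R := f (upd s x (nnr xi)).

Definition unif_outer (x : V) f : S -> \bar R :=
  fun s => upper_integral lebesgue_measure `[0%R, 1%R] (section_at f x s).

Definition outer_wp := wp_with unif_outer.

Lemma unif_int_ge0 x f : is_expectation f -> is_expectation (unif_int x f).
Proof. by move=> f0 s; apply: integral_ge0 => xi _; exact: f0. Qed.

Lemma unif_outer_ge0 x f : is_expectation f -> is_expectation (unif_outer x f).
Proof. by move=> f0 s; apply: upper_integral_ge0 => xi _; exact: f0. Qed.

Lemma unif_lower_ge0 N x f :
  is_expectation f -> is_expectation (unif_lower N x f).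
Proof. by move=> f0 s; apply: lower_sum_ge0 => xi; exact: f0. Qed.

Lemma unif_upper_ge0 N x f :
  is_expectation f -> is_expectation (unif_upper N x f).
Proof. by move=> f0 s; apply: upper_sum_ge0 => xi; exact: f0. Qed.

Lemma lower_wp_le_wp N C f s : (0 < N)%N -> pWhile calE calG C ->
  is_expectation f -> lower_wp N C f s <= wp C f s.
Proof.
move=> N0 hC f0; apply: wp_with_le hC f0 _ _ => //.
  by move=> x g; exact: unif_lower_ge0.
move=> x g h g0 gh t; apply: (@le_trans _ _ (unif_lower N x h t)).
  by apply: lower_sum_mono => xi; exact: gh.
apply: lower_sum_le_integral => // xi; apply: le_trans (gh _); exact: g0.
Qed.

Lemma wp_le_upper_wp N C f s : (0 < N)%N -> pWhile calE calG C ->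
  is_expectation f -> wp C f s <= upper_wp N C f s.
Proof.
move=> N0 hC f0; apply: wp_with_le hC f0 _ _ => //.
  by move=> x g; exact: unif_int_ge0.
move=> x g h g0 gh t; apply: (@le_trans _ _ (unif_upper N x g t)).
  apply: le_trans (upper_integral_le_upper_sum N0 _).
    by apply: integral_le_upper => xi _; exact: g0.
  by move=> xi; exact: g0.
by apply: upper_sum_mono => xi; exact: gh.
Qed.

Lemma lower_wp_le_outer_wp N C f s : (0 < N)%N -> pWhile calE calG C ->
  is_expectation f -> lower_wp N C f s <= outer_wp C f s.
Proof.
move=> N0 hC f0; apply: wp_with_le hC f0 _ _ => //.
  by move=> x g; exact: unif_lower_ge0.
move=> x g h g0 gh t; apply: (@le_trans _ _ (unif_lower N x h t)).
  by apply: lower_sum_mono => xi; exact: gh.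
have h0 xi : 0 <= section_at h x t xi by apply: le_trans (gh _); exact: g0.
apply: le_trans (lower_sum_le_integral N0 h0) _.
by apply: integral_le_upper => xi _; exact: h0.
Qed.

Lemma wp_mono C f g s : pWhile calE calG C -> is_expectation f ->
  (forall t, f t <= g t) -> wp C f s <= wp C g s.
Proof.
move=> hC f0 fg; apply: wp_with_le hC f0 fg s.
  by move=> x h; exact: unif_int_ge0.
move=> x h k h0 hk t; apply: ge0_integral_mono => xi _; first exact: h0.
exact: hk.
Qed.

Lemma outer_wp_mono C f g s : pWhile calE calG C -> is_expectation f ->
  (forall t, f t <= g t) -> outer_wp C f s <= outer_wp C g s.
Proof.
move=> hC f0 fg; apply: wp_with_le hC f0 fg s.
  by move=> x h; exact: unif_outer_ge0.
by move=> x h k h0 hk t; apply: upper_integral_mono => xi _; exact: hk.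
Qed.

Lemma wp_le_outer_wp C f s : pWhile calE calG C -> is_expectation f ->
  wp C f s <= outer_wp C f s.
Proof.
move=> hC f0; apply: wp_with_le hC f0 _ _ => //.
  by move=> x h; exact: unif_int_ge0.
move=> x h k h0 hk t; apply: (@le_trans _ _ (unif_outer x h t)).
  by apply: integral_le_upper => xi _; exact: h0.
by apply: upper_integral_mono => xi _; exact: hk.
Qed.

(** Index and post-expectation vary together because in a composition both depend on the
    exponent. *)
Lemma lower_wp_mono C m n f g s : (m <= n)%N -> pWhile calE calG C ->
  is_expectation f -> (forall t, f t <= g t) ->
  lower_wp (2 ^ m) C f s <= lower_wp (2 ^ n) C g s.
Proof.
move=> mn hC f0 fg; apply: wp_with_le hC f0 fg s.
  by move=> x h; exact: unif_lower_ge0.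
move=> x h k h0 hk t; apply: (@le_trans _ _ (unif_lower (2 ^ m) x k t)).
  by apply: lower_sum_mono => xi; exact: hk.
have /nondecreasing_seqP : forall i, lower_sum (2 ^ i) (section_at k x t) <=
    lower_sum (2 ^ i.+1) (section_at k x t).
  by move=> i; rewrite expnSr; exact: lower_sum_double.
exact.
Qed.

Lemma upper_wp_mono C m n f g s : (m <= n)%N -> pWhile calE calG C ->
  is_expectation f -> (forall t, f t <= g t) ->
  upper_wp (2 ^ n) C f s <= upper_wp (2 ^ m) C g s.
Proof.
move=> mn hC f0 fg; apply: wp_with_le hC f0 fg s.
  by move=> x h; exact: unif_upper_ge0.
move=> x h k h0 hk t; apply: (@le_trans _ _ (unif_upper (2 ^ n) x k t)).
  by apply: upper_sum_mono => xi; exact: hk.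
have /nonincreasing_seqP : forall i, upper_sum (2 ^ i.+1) (section_at k x t) <=
    upper_sum (2 ^ i) (section_at k x t).
  by move=> i; rewrite expnSr; exact: upper_sum_double.
exact.
Qed.

(** Only binary rational mixtures are available, so averages are built one term at a time: the
    average of [n.+1] terms gets weight [n.+1 / n.+2] and the new term the remaining [1 / n.+2]. *)
Lemma suitable_average n (u : nat -> S -> \bar R) :
  (forall i, (i <= n)%N -> calF (u i)) ->
  calF (fun s => (n.+1%:R^-1)%:E * \sum_(i < n.+1) u i s).
Proof.
elim: n => [|n IHn] uF.
  rewrite (_ : (fun _ => _) = u 0%N); first exact: uF.
  by apply/funext => s; rewrite big_ord1 invr1 mul1e.
pose p : rat := (n.+1%:R / n.+2%:R)%R.
rewrite (_ : (fun _ => _) =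
  mix_prob p (fun s => (n.+1%:R^-1)%:E * \sum_(i < n.+1) u i s) (u n.+1)).
  apply: (suitable_F_prob suitable); [|exact: uF|].
    by apply: IHn => i ni; apply: uF; exact: leqW.
  rewrite /rat01 divr_ge0//= ler_pdivrMr ?ltr0n// mul1r ler_nat.
  exact: leqnSn.
have u0 i s : (i <= n.+1)%N -> 0 <= u i s.
  by move=> /uF/(suitable_F_expectation suitable); exact.
apply/funext => s; rewrite /mix_prob big_ord_recr/= ge0_muleDr; last 2 first.
  by apply: sume_ge0 => i _; apply: u0; rewrite ltnW// ltnS ltnW.
  exact: u0.
have pE : ratr p = (n.+1%:R / n.+2%:R)%R :> R.
  by rewrite rmorphM/= fmorphV !rmorph_nat.
rewrite muleA -EFinM; congr (_%:E * _ + _%:E * _).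
  by rewrite pE mulrAC divff ?mul1r// pnatr_eq0.
rewrite pE -[X in (X - _)%R](@divff _ n.+2%:R) ?pnatr_eq0// -mulrBl.
by rewrite -natrB// subSnn mul1r.
Qed.

Lemma cell_bounds N i : (i < N)%N ->
  [/\ 0 <= i%:R / N%:R :> R, i%:R / N%:R <= i.+1%:R / N%:R :> R &
      i.+1%:R / N%:R <= 1 :> R]%R.
Proof.
move=> iN; have N0 : (0 < N%:R :> R)%R by rewrite ltr0n (leq_trans _ iN).
rewrite divr_ge0// ler_pM2r ?invr_gt0// ler_nat leqnSn.
by rewrite ler_pdivrMr// mul1r ler_nat.
Qed.

Lemma unif_lower_closed N x f : (0 < N)%N -> calF f -> calF (unif_lower N x f).
Proof.
case: N => // n _ Ff; apply: (@suitable_average n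
  (fun i => inf_subst (i%:R / n.+1%:R) (i.+1%:R / n.+1%:R) x f)) => i ni.
have [a0 ab b1] := @cell_bounds n.+1 i ni.
by have [] := @suitable_F_inf_sup _ _ _ _ _ suitable f x _ _ Ff a0 ab b1.
Qed.

Lemma unif_upper_closed N x f : (0 < N)%N -> calF f -> calF (unif_upper N x f).
Proof.
case: N => // n _ Ff; apply: (@suitable_average n
  (fun i => sup_subst (i%:R / n.+1%:R) (i.+1%:R / n.+1%:R) x f)) => i ni.
have [a0 ab b1] := @cell_bounds n.+1 i ni.
by have [] := @suitable_F_inf_sup _ _ _ _ _ suitable f x _ _ Ff a0 ab b1.
Qed.

Lemma lower_wp_closed N C f : (0 < N)%N -> pWhile calE calG C -> calF f ->
  calF (lower_wp N C f).
Proof.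
by move=> N0; apply: wp_with_closed suitable _ _ _ => x g;
  exact: unif_lower_closed.
Qed.

Lemma upper_wp_closed N C f : (0 < N)%N -> pWhile calE calG C -> calF f ->
  calF (upper_wp N C f).
Proof.
by move=> N0; apply: wp_with_closed suitable _ _ _ => x g;
  exact: unif_upper_closed.
Qed.

(** The supremum over the unit interval is itself in [calF], so local boundedness on the compact
    singleton of [s] makes it finite there. *)
Lemma suitable_section_bounded f x s : calF f ->
  exists c : R, forall xi : R, `[0%R, 1%R]%classic xi ->
    section_at f x s xi <= c%:E.
Proof.
move=> Ff; have [|||_ Fg] := @suitable_F_inf_sup _ _ _ _ _ suitable f x 0 1 Ff.
- by [].
- exact: ler01.
- by [].
set g := sup_subst 0 1 x f in Fg.
have := suitable_F_bounded suitable Fg (@compact_set1 _ s).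
rewrite image_set1 ereal_sup1 => gfin; exists (fine (g s)) => xi xi01.
rewrite fineK; last by rewrite fin_num_abs.
by apply: ereal_sup_ubound; exists xi.
Qed.

Lemma unif_upper_cvg x f s : calF f ->
  unif_upper (2 ^ k) x f s @[k --> \oo] --> unif_int x f s.
Proof.
move=> Ff; have [c fc] := suitable_section_bounded x s Ff.
have [_ fR] := suitable_F_riemann suitable x Ff s.
apply: (upper_sum_cvg (h := section_at f x s) _ fc fR) => xi.
exact: suitable_F_expectation suitable _ Ff _.
Qed.

Lemma unif_lower_cvg x f s : calF f ->
  unif_lower (2 ^ k) x f s @[k --> \oo] --> unif_outer x f s.
Proof.
move=> Ff; have [c fc] := suitable_section_bounded x s Ff.
have [_ fR] := suitable_F_riemann suitable x Ff s.
apply: (lower_sum_cvg (h := section_at f x s) _ fc fR) => xi.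
exact: suitable_F_expectation suitable _ Ff _.
Qed.

(** The invariant is being a nondecreasing sequence of expectations, which [outer_wp] preserves;
    sampling is handled by [upper_integral_cvg]. *)
Lemma outer_wp_cvg C u f s : pWhile calE calG C ->
  (forall n, is_expectation (u n)) ->
  (forall t, nondecreasing_seq (u ^~ t)) ->
  (forall t, u n t @[n --> \oo] --> f t) ->
  outer_wp C (u n) s @[n --> \oo] --> outer_wp C f s.
Proof.
move=> hC u0 und uf; pose Q (v : nat -> S -> \bar R) :=
  (forall n, is_expectation (v n)) /\ forall t, nondecreasing_seq (v ^~ t).
apply: (@wp_with_cvg _ _ calE calG unif_outer Q) => //.
- by move=> v n [].
- move=> D v hD [v0 vnd]; split=> [n|t m n mn].
    by apply: wp_with_ge0 hD (v0 n) => x g; exact: unif_outer_ge0.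
  by apply: outer_wp_mono hD (v0 m) _ => r; exact: vnd.
- move=> x v g [v0 vnd] vg t; apply: upper_integral_cvg.
  + exact: measurable_itv.
  + by move=> n xi _; exact: v0.
  + by move=> xi _; exact: vnd.
  + by move=> xi _; exact: vg.
Qed.

(** Domination by a member of [calF] is part of the invariant, as it supplies the constant bound
    that [integral_cvg_nonincreasing] requires at each sampling. *)
Lemma wp_cvg C u f F0 s : pWhile calE calG C -> calF F0 ->
  (forall n, is_expectation (u n)) ->
  (forall n t, u n t <= F0 t) ->
  (forall t, nonincreasing_seq (u ^~ t)) ->
  (forall t, u n t @[n --> \oo] --> f t) ->
  wp C (u n) s @[n --> \oo] --> wp C f s.
Proof.
move=> hC F0F u0 uF uni uf; pose Q (v : nat -> S -> \bar R) :=
  [/\ forall n, is_expectation (v n), forall t, nonincreasing_seq (v ^~ t) &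
    exists2 F1, calF F1 & forall n t, v n t <= F1 t].
apply: (@wp_with_cvg _ _ calE calG (@unif_int V R) Q) => //.
- by move=> v n [].
- move=> D v hD [v0 vni [F1 F1F vF]]; split=> [n|t m n mn|].
  + by apply: wp_with_ge0 hD (v0 n) => x g; exact: unif_int_ge0.
  + by apply: wp_mono hD (v0 n) _ => r; exact: vni.
  (* The coarsest upper transformer keeps the dominating function inside [calF], where [wp D F1]
     might not be. *)
  + exists (upper_wp 1 D F1); first exact: upper_wp_closed.
    move=> n t; apply: le_trans (wp_mono t hD (v0 n) (vF n)) _.
    by apply: wp_le_upper_wp hD (suitable_F_expectation suitable F1F).
- move=> x v g [v0 vni [F1 F1F vF]] vg t.
  have [c Fc] := suitable_section_bounded x t F1F.
  apply: (@integral_cvg_nonincreasing _ _ _ _ _ _ _ _ c).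
  + exact: measurable_itv.
  + have : lebesgue_measure (`[0%R, 1%R]%classic : set R) < +oo.
      by rewrite lebesgue_measure_itv/= lte01 sube0 ltry.
    exact.
  + by move=> n xi /Fc; rewrite v0/=; apply: le_trans; exact: vF.
  + by move=> xi _; exact: vni.
  + by move=> xi _; exact: vg.
- by split=> //; exists F0.
Qed.

Lemma upper_wp_cvg C f s : pWhile calE calG C -> calF f ->
  upper_wp (2 ^ k) C f s @[k --> \oo] --> wp C f s.
Proof.
move=> hC Ff; apply: (@wp_with_approx _ _ calE calG
  (fun k => @unif_upper V R (2 ^ k)) (@unif_int V R) calF) hC Ff s.
- exact: suitable_F_expectation suitable.
- by move=> k x g; exact: unif_upper_ge0.
- by move=> g E x; exact: (suitable_F_subst suitable).
- by move=> x g Fg t; exact: unif_upper_cvg.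
move=> {C f} C1 C2 f h1 h2 Ff IH1 IH2 s.
have k0 k : (0 < 2 ^ k)%N by rewrite expn_gt0.
pose g k := upper_wp (2 ^ k) C2 f; pose w k := upper_wp (2 ^ k) C1 (g k) s.
have f0 := suitable_F_expectation suitable Ff.
have gF k : calF (g k) by exact: upper_wp_closed.
have g0 k : is_expectation (g k) by exact: suitable_F_expectation suitable _ _.
have gni t : nonincreasing_seq (g ^~ t).
  by move=> m n mn; exact: upper_wp_mono.
have wni : nonincreasing_seq w.
  by move=> m n mn; apply: upper_wp_mono => // t; exact: gni.
have := ereal_nonincreasing_cvgn wni; set L := ereal_inf _.
suff -> : L = wp C1 (wp C2 f) s by [].
have wpg : wp C1 (g m) s @[m --> \oo] --> wp C1 (wp C2 f) s.
  (* The sequence [g] decreases inside [calF], so its first term dominates it. *)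
  by apply: (@wp_cvg C1 g _ (g 0%N)) => // n t; exact: gni.
apply/eqP; rewrite eq_le; apply/andP; split.
  (* The diagonal is decoupled: for fixed [m] and all [k] past [m], [w k] is at most
     [upper_wp (2 ^ k) C1 (g m) s]. First [k] tends to infinity, which is possible as [g m] is in
     [calF], and then [m]. *)
  apply: (cvge_to_ge wpg); apply: nearW => m.
  apply: (cvge_to_ge (IH1 _ s (gF m))).
  near=> k; apply: (@le_trans _ _ (w k)).
    by apply: ereal_inf_lbound; exists k.
  apply: upper_wp_mono => // t; apply: gni; near: k; exact: nbhs_infty_ge.
apply: le_ereal_inf_tmp => _ [k _ <-].
apply: le_trans (wp_le_upper_wp s (k0 k) h1 (g0 k)).
apply: wp_mono h1 _ _ => [|t]; last exact: wp_le_upper_wp.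
by apply: wp_with_ge0 h2 f0 => x h; exact: unif_int_ge0.
Unshelve. all: by end_near.
Qed.

Lemma lower_wp_cvg C f s : pWhile calE calG C -> calF f ->
  lower_wp (2 ^ k) C f s @[k --> \oo] --> outer_wp C f s.
Proof.
move=> hC Ff; apply: (@wp_with_approx _ _ calE calG
  (fun k => @unif_lower V R (2 ^ k)) unif_outer calF) hC Ff s.
- exact: suitable_F_expectation suitable.
- by move=> k x g; exact: unif_lower_ge0.
- by move=> g E x; exact: (suitable_F_subst suitable).
- by move=> x g Fg t; exact: unif_lower_cvg.
move=> {C f} C1 C2 f h1 h2 Ff IH1 IH2 s.
have k0 k : (0 < 2 ^ k)%N by rewrite expn_gt0.
pose g k := lower_wp (2 ^ k) C2 f; pose w k := lower_wp (2 ^ k) C1 (g k) s.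
have f0 := suitable_F_expectation suitable Ff.
have gF k : calF (g k) by exact: lower_wp_closed.
have g0 k : is_expectation (g k) by exact: suitable_F_expectation suitable _ _.
have gnd t : nondecreasing_seq (g ^~ t).
  by move=> m n mn; exact: lower_wp_mono.
have wnd : nondecreasing_seq w.
  by move=> m n mn; apply: lower_wp_mono => // t; exact: gnd.
have := ereal_nondecreasing_cvgn wnd; set L := ereal_sup _.
suff -> : L = outer_wp C1 (outer_wp C2 f) s by [].
have wpg : outer_wp C1 (g m) s @[m --> \oo] --> outer_wp C1 (outer_wp C2 f) s.
  exact: outer_wp_cvg.
apply/eqP; rewrite eq_le; apply/andP; split.
  apply: ge_ereal_sup => _ [k _ <-].
  apply: le_trans (lower_wp_le_outer_wp s (k0 k) h1 (g0 k)) _.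
  by apply: outer_wp_mono h1 (g0 k) _ => t; exact: lower_wp_le_outer_wp.
(* The same double limit with inequalities reversed: [k] first, for fixed [m], then [m]. *)
apply: (cvge_to_le wpg); apply: nearW => m.
apply: (cvge_to_le (IH1 _ s (gF m))).
near=> k; apply: (@le_trans _ _ (w k)).
  apply: lower_wp_mono => // t; apply: gnd; near: k; exact: nbhs_infty_ge.
by apply: ereal_sup_ubound; exists k.
Unshelve. all: by end_near.
Qed.

End RiemannSuitable.

Theorem lemma7p4 (V : finType) (R : realType)
    (calE : set (state V R -> nnreal R)) (calG : set (state V R -> bool))
    (calF : set (state V R -> \bar R))
    (suitable : riemann_suitable calE calG calF)
    (C : prog V R) (hC : pWhile calE calG C)
    (f : state V R -> \bar R) (hf : calF f) :
  (forall N : nat, (1 <= N)%N ->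
     calF (lower_wp N C f) /\ calF (upper_wp N C f)) /\
  (expectation_meas f ->
     wp C f = (fun s => ereal_sup
       [set lower_wp N C f s | N in [set N : nat | (1 <= N)%N]]) /\
     wp C f = (fun s => ereal_inf
       [set upper_wp N C f s | N in [set N : nat | (1 <= N)%N]])).
Proof.
have f0 := suitable_F_expectation suitable hf.
have k0 k : (1 <= 2 ^ k)%N by rewrite expn_gt0.
split=> [N N1|_].
  split; first exact: (lower_wp_closed suitable).
  exact: (upper_wp_closed suitable).
split; apply/funext => s; apply/eqP; rewrite eq_le; apply/andP; split.
(* Bounds valid for every [N] give one half of each equality; the limits along powers of two give
   the other, here through the outer transformer. *)
- apply: le_trans (wp_le_outer_wp s hC f0) _.
  apply: (cvge_to_le (lower_wp_cvg suitable hC hf)); apply: nearW => k.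
  by apply: ereal_sup_ubound; exists (2 ^ k)%N => //=.
- by apply: ge_ereal_sup => _ [N N1 <-]; exact: lower_wp_le_wp hC f0.
- by apply: le_ereal_inf_tmp => _ [N N1 <-]; exact: wp_le_upper_wp hC f0.
- apply: (cvge_to_ge (upper_wp_cvg suitable hC hf)); apply: nearW => k.
  by apply: ereal_inf_lbound; exists (2 ^ k)%N => //=.
Qed.
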